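(* Let $G$ be a (finite, simple, non-null) graph without isolated vertices such that $\Delta(G)-\delta(G)\leq 3$. If $\frac{M_1(G)}{n(G)}>\frac{M_2(G)}{m(G)}$, then $\delta(G)=2$, $\Delta(G)=5$, $m_{2,5}(G)\neq 0$, and $m_{3,3}(G)\neq 0$.
   Context: All graphs are finite, simple, non-null and have no isolated vertices (they need not be connected). For a graph $G$ with vertex set $V(G)$ and edge set $E(G)$: $n(G)=|V(G)|$ is the order, $m(G)=|E(G)|$ is the size, $d_G(u)$ is the degree of a vertex $u$, and $\Delta(G)$ and $\delta(G)$ are the maximum and minimum degrees. The first and second Zagreb indices are $M_1(G)=\sum_{v\in V(G)}d_G(v)^2$ and $M_2(G)=\sum_{uv\in E(G)}d_G(u)d_G(v)$. For positive integers $i,j$, $m_{i,j}(G)$ is the number of edges of $G$ joining a vertex of degree $i$ to a vertex of degree $j$. *)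

(* Defs.v *)
From mathcomp Require Import all_boot.

Set Implicit Arguments.
Unset Strict Implicit.
Unset Printing Implicit Defensive.

Record sgraph := SGraph {
  vertex :> finType;
  adj : rel vertex;
  adj_sym : symmetric adj;
  adj_irrefl : irreflexive adj
}.

Section Invariants.
Variable G : sgraph.

(* An edge is the unordered pair of its two (distinct) ends. *)
Definition edges : {set {set G}} :=
  [set [set p.1; p.2] | p in [set p : G * G | adj p.1 p.2]].

Definition gorder : nat := #|G|.
Definition gsize : nat := #|edges|.

Definition deg (v : G) : nat := #|[set w | adj v w]|.

Definition max_deg : nat := \max_(v : G) deg v.

(* Every degree is at most #|G|, so this default never affects the minimum
   when G has a vertex. *)
Definition min_deg : nat := \big[minn/#|G|]_(v : G) deg v.

Definition isolated (v : G) : bool := deg v == 0.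

Definition zagreb1 : nat := \sum_(v : G) deg v ^ 2.

(* The product runs over the two ends of the edge uv. *)
Definition zagreb2 : nat := \sum_(uv in edges) \prod_(w in uv) deg w.

Definition edge_count (i j : nat) : nat :=
  #|[set uv in edges | [exists u, exists v,
       [&& uv == [set u; v], deg u == i & deg v == j]]]|.

End Invariants.

(* Main.v *)
Require Import Defs.
From mathcomp Require Import all_boot all_order all_algebra.
From mathcomp Require Import zify ring lra.

(** Write [p(uv) = d(u) d(v)] and [h(uv) = 1/d(u) + 1/d(v)].  Summing over the
    edges, [m = sum 1], [M_2 = sum p], [n = sum h] (no vertex is isolated) and
    [M_1 = sum p h], so the hypothesis says that [p] and [h] are positively
    correlated on the edges.  By Chebyshev's sum inequality some two edges
    satisfy [p(e) > p(f)] and [h(e) > h(f)].  With all degrees in an interval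
    [[d, d + 3]], the only possibility is [d = 2], with [e] of type (2,5) and
    [f] of type (3,3): indeed [10 > 9] and [7/10 > 2/3]. *)

Set Implicit Arguments.
Unset Strict Implicit.
Unset Printing Implicit Defensive.

Import Order.TTheory GRing.Theory Num.Theory.

Section Chebyshev.
Local Open Scope ring_scope.

(** Expanding the product, the two diagonal terms each give [#|D|] copies of the sum of [f x * g x],
    and the two cross terms each factor. The sign of the double sum thus tells how [f] and [g] are
    correlated on [D]. *)
Lemma sum_sub_mul_sub (R : comNzRingType) (I : finType) (D : {set I})
    (f g : I -> R) :
  \sum_(x in D) \sum_(y in D) (f x - f y) * (g x - g y) =
  (#|D|%:R * (\sum_(x in D) f x * g x)
   - (\sum_(x in D) f x) * (\sum_(x in D) g x)) *+ 2.
Proof.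
pose S h : R := \sum_(x in D) h x.
have inner x : \sum_(y in D) (f x - f y) * (g x - g y) =
    #|D|%:R * (f x * g x) - f x * S g - g x * S f + S (fun y => f y * g y).
  transitivity (\sum_(y in D)
      (f x * g x - f x * g y - g x * f y + f y * g y)).
    by apply: eq_bigr => y _; ring.
  by rewrite !big_split /= !sumrN -!mulr_sumr sumr_const mulrnAr mulr_natl.
rewrite (eq_bigr _ (fun x _ => inner x)) !big_split /= !sumrN.
by rewrite -!mulr_suml -!mulr_sumr sumr_const -mulr_natl /S; ring.
Qed.

(** Were no pair concordant, every term of the double sum in [sum_sub_mul_sub] would be at most 0,
    and so would its closed form. *)
Lemma chebyshev_concordant (R : realDomainType) (I : finType) (D : {set I})
    (f g : I -> R) :
  (\sum_(x in D) f x) * (\sum_(x in D) g x)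
    < #|D|%:R * (\sum_(x in D) f x * g x) ->
  exists x y, [/\ x \in D, y \in D, f y < f x & g y < g x].
Proof.
move=> lt_fg.
have [/existsP[x /andP[xD /existsP[y /and3P[yD ? ?]]]]|none] := boolP
    [exists x, (x \in D) && [exists y, [&& y \in D, f y < f x & g y < g x]]].
  by exists x, y.
have disc x y : x \in D -> y \in D -> f y < f x -> g x <= g y.
  move=> xD yD ltf; rewrite leNgt; apply: contra none => ltg.
  by apply/existsP; exists x; rewrite xD; apply/existsP; exists y; apply/and3P.
have : \sum_(x in D) \sum_(y in D) (f x - f y) * (g x - g y) <= 0.
  apply: sumr_le0 => x xD; apply: sumr_le0 => y yD.
  have [ltf|ltf|->] := ltgtP (f x) (f y); last by rewrite subrr mul0r.
    by apply: mulr_le0_ge0; rewrite ?subr_le0 ?subr_ge0 ?disc // ltW.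
  by apply: mulr_ge0_le0; rewrite ?subr_le0 ?subr_ge0 ?disc // ltW.
by rewrite sum_sub_mul_sub pmulrn_lle0 // subr_le0 leNgt lt_fg.
Qed.

End Chebyshev.

(** After sorting both pairs, the inequalities force [i < k <= l < j], so [j - i] is 2 or 3. Of the
    few types left, all but [(d, d+3)] against [(d+1, d+1)] violate the product inequality. *)
Lemma concordant_types (d i j k l : nat) : 0 < d ->
    d <= i <= d + 3 -> d <= j <= d + 3 -> d <= k <= d + 3 -> d <= l <= d + 3 ->
    k * l < i * j -> (k + l) * (i * j) < (i + j) * (k * l) ->
  [/\ d = 2, (i = 2 /\ j = 5) \/ (i = 5 /\ j = 2), k = 3 & l = 3].
Proof.
wlog ij : i j / i <= j => [th d0 hi hj hk hl lt1 lt2|].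
  case: (leqP i j) => [ij|/ltnW ji]; first exact: th.
  have [||d2 h k3 l3] := th j i ji d0 hj hi hk hl.
  - by rewrite (mulnC j).
  - by rewrite (mulnC j) (addnC j).
  by split=> //; tauto.
wlog kl : k l / k <= l => [th d0 hi hj hk hl lt1 lt2|].
  case: (leqP k l) => [kl|/ltnW lk]; first exact: th.
  have [||d2 h k3 l3] := th l k lk d0 hi hj hl hk.
  - by rewrite (mulnC l).
  - by rewrite (mulnC l) (addnC l).
  by split.
move=> d0 hi hj hk hl lt1 lt2.
have lt_ik : i < k.
  rewrite ltnNge; apply/negP => le_ki; case: (leqP l j) => [le_lj|lt_jl].
    (* Here [1/i <= 1/k] and [1/j <= 1/l], so the reciprocal sums compare the wrong way. *)
    have : k * i * l <= k * i * j by rewrite leq_mul.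
    have : l * j * k <= l * j * i by rewrite leq_mul.
    lia.
  (* Here [1/k - 1/i < 1/j - 1/l], i.e. [a j l < b k i], while [k b <= a j]. *)
  have [a Ea] : exists a, i = k + a by exists (i - k); lia.
  have [b Eb] : exists b, l = j + b by exists (l - j); lia.
  have le_kbaj : k * b <= a * j by subst; lia.
  have : k * b * i <= a * j * i by rewrite leq_mul.
  have : a * j * i <= a * j * l by rewrite leq_mul //; lia.
  subst; lia.
have lt_lj : l < j.
  rewrite ltnNge; apply/negP => le_jl.
  by have := leq_mul (ltnW lt_ik) le_jl; lia.
have [[? ?]|[[? ?]|?]] : (i = d /\ j = d + 2) \/ (i = d /\ j = d + 3) \/ (i = d + 1 /\ j = d + 3) by lia.
- have [? ?] : k = d + 1 /\ l = d + 1 by lia.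
  by subst; lia.
- have [[? ?]|[[? ?]|[? ?]]] : (k = d + 1 /\ l = d + 1) \/
      (k = d + 1 /\ l = d + 2) \/ (k = d + 2 /\ l = d + 2) by lia.
  (* [lt1] reads [(d+1)^2 < d(d+3)], that is [1 < d]; [lt2] divided by [d+1] reads
     [2d(d+3) < (2d+3)(d+1)], that is [d < 3]. *)
  + have lt_1d : 1 < d by subst; lia.
    have lt_d3 : d < 3 by subst; nia.
    by split; lia.
  + by subst; lia.
  + by subst; lia.
- have [? ?] : k = d + 2 /\ l = d + 2 by lia.
  by subst; lia.
Qed.

Section Darts.
Variable G : sgraph.
Implicit Types u v w : G.

(** Oriented edges: unlike an unordered pair, a dart gives direct access to its two ends. *)
Definition darts : {set G * G} := [set p | adj p.1 p.2].

Lemma dart_fibre u v : adj u v ->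
  forall p, (p \in darts) && ([set p.1; p.2] == [set u; v]) =
            (p \in [set (u, v); (v, u)]).
Proof.
move=> uv [a b]; rewrite !inE /= !xpair_eqE.
apply/andP/orP => [[ab /eqP eq_e]|].
  have neq_ab : a != b by apply: contraTneq ab => ->; rewrite adj_irrefl.
  have : a \in [set u; v] by rewrite -eq_e set21.
  have : b \in [set u; v] by rewrite -eq_e set22.
  rewrite !inE => /orP[]/eqP eqb /orP[]/eqP eqa; subst; move: neq_ab;
    rewrite !eqxx //; by [right | left].
by case=> /andP[/eqP-> /eqP->]; split; rewrite // 1?adj_sym // setUC.
Qed.

Lemma edgeP (e : {set G}) :
  reflect (exists u v, adj u v /\ e = [set u; v]) (e \in edges G).
Proof.
apply: (iffP imsetP) => [[[u v]]|[u [v [uv ->]]]].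
  by rewrite inE => uv ->; exists u, v.
by exists (u, v); rewrite ?inE.
Qed.

Local Open Scope ring_scope.

(** Grouped by underlying edge, the darts fall into fibres of two orientations, distinct because
    [adj] is irreflexive. *)
Lemma sum_darts (V : nmodType) (F : {set G} -> V) :
  \sum_(p in darts) F [set p.1; p.2] = (\sum_(e in edges G) F e) *+ 2.
Proof.
rewrite (partition_big_imset (fun p : G * G => [set p.1; p.2])) /=.
rewrite -sumrMnl; apply: eq_bigr => e /edgeP[u [v [uv ->]]].
rewrite (eq_bigr (fun=> F [set u; v])) => [|p /andP[_ /eqP->] //].
rewrite (eq_bigl _ _ (dart_fibre uv)) sumr_const cards2 xpair_eqE.
by have [eq_uv|//] := eqVneq u v; rewrite eq_uv adj_irrefl in uv.
Qed.

Lemma card_darts : #|darts| = (gsize G * 2)%N.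
Proof.
rewrite /gsize -!sum1_card muln2 -addnn.
exact: (@sum_darts nat (fun=> 1%N)).
Qed.

Lemma sum_darts_deg_mul (R : comNzRingType) :
  \sum_(p in darts) (deg p.1)%:R * (deg p.2)%:R = (zagreb2 G)%:R *+ 2 :> R.
Proof.
rewrite natr_sum -sum_darts; apply: eq_bigr => -[u v]; rewrite inE /= => uv.
have neq_uv : u != v by apply: contraTneq uv => ->; rewrite adj_irrefl.
by rewrite big_setU1 ?inE //= big_set1 natrM.
Qed.

(** A vertex [u] starts [deg u] darts, and reversing darts gives the same sum over second ends.
    Taking [F] to be [1/deg] or [deg] yields twice [n] or twice [M_1]. *)
Lemma sum_darts_ends (V : nmodType) (F : G -> V) :
  \sum_(p in darts) (F p.1 + F p.2) = (\sum_u F u *+ deg u) *+ 2.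
Proof.
have sum1 : \sum_(p in darts) F p.1 = \sum_u F u *+ deg u.
  rewrite (eq_bigl (fun p : G * G => true && adj p.1 p.2)) => [|p]; last first.
    by rewrite inE.
  rewrite -(pair_big_dep xpredT (@adj G) (fun u _ => F u)) /=.
  by apply: eq_bigr => u _; rewrite -big_set /= sumr_const.
rewrite big_split /= mulr2n -{2}sum1; congr (_ + _); first exact: sum1.
have swap_inj : injective (fun p : G * G => (p.2, p.1)).
  by move=> [a b] [c e] [-> ->].
rewrite [LHS](reindex_inj swap_inj) /=.
by apply: eq_bigl => p; rewrite !inE adj_sym.
Qed.

End Darts.

Lemma min_deg_le (G : sgraph) (v : G) : min_deg G <= deg v.
Proof.
rewrite /min_deg; elim: (index_enum G) (mem_index_enum v) => // w s IH.
by rewrite inE big_cons geq_min => /predU1P[->|/IH->]; rewrite ?leqnn ?orbT.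
Qed.

Lemma max_deg_ge (G : sgraph) (v : G) : deg v <= max_deg G.
Proof. exact: (leq_bigmax v). Qed.

Lemma min_deg_gt0 (G : sgraph) :
  0 < gorder G -> (forall v : G, 0 < deg v) -> 0 < min_deg G.
Proof.
(* The default [#|G|] of the minimum is positive by [n0]. *)
move=> n0 pos; rewrite /min_deg; elim/big_ind: _ => // x y x0 y0.
by rewrite leq_min x0.
Qed.

Lemma edge_count_neq0 (G : sgraph) (u v : G) :
  adj u v -> edge_count G (deg u) (deg v) <> 0.
Proof.
move=> uv; apply/eqP; rewrite -lt0n; apply/card_gt0P; exists [set u; v].
rewrite inE; apply/andP; split; first by apply/edgeP; exists u, v.
by apply/existsP; exists u; apply/existsP; exists v; rewrite !eqxx.
Qed.

(* The last inequality is [1/d(x) + 1/d(y) < 1/d(u) + 1/d(v)] with denominators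
   cleared. *)
Lemma exists_concordant_edges (G : sgraph) :
    0 < gorder G -> (forall v : G, 0 < deg v) ->
    ((zagreb2 G)%:R / (gsize G)%:R < (zagreb1 G)%:R / (gorder G)%:R :> rat)%R ->
  exists u v x y : G, [/\ adj u v, adj x y, deg x * deg y < deg u * deg v &
    (deg x + deg y) * (deg u * deg v) < (deg u + deg v) * (deg x * deg y)].
Proof.
move=> n0 pos ratio_gt.
pose d (u : G) : rat := ((deg u)%:R)%R.
have d0 u : (0 < d u)%R by rewrite ltr0n.
have dn0 u : (d u != 0)%R by rewrite gt_eqF.
pose p (e : G * G) := (d e.1 * d e.2)%R.
pose h (e : G * G) := ((d e.1)^-1 + (d e.2)^-1)%R.
have sum_h : (\sum_(e in darts G) h e = (gorder G)%:R *+ 2)%R.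
  rewrite (sum_darts_ends (fun u => (d u)^-1)%R) -sumr_const; congr (_ *+ 2)%R.
  by apply: eq_bigr => u _; rewrite -mulr_natr mulVf.
have sum_ph : (\sum_(e in darts G) p e * h e = (zagreb1 G)%:R *+ 2)%R.
  rewrite natr_sum.
  transitivity (\sum_(e in darts G) (d e.1 + d e.2))%R.
    by apply: eq_bigr => e _; rewrite /p /h; field; rewrite !dn0.
  rewrite (sum_darts_ends d); congr (_ *+ 2)%R; apply: eq_bigr => u _.
  by rewrite -[LHS]mulr_natr natrX expr2.
(* Clearing the denominator [m] requires [m > 0]; without edges, [sum_h] would give [n = 0]. *)
have m0 : 0 < gsize G.
  rewrite lt0n; apply/eqP => m0.
  have D0 : darts G = set0 by apply/eqP; rewrite -cards_eq0 card_darts m0.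
  move/eqP: sum_h; rewrite D0 big_set0 eq_sym mulrn_eq0 /= pnatr_eq0.
  by rewrite eqn0Ngt n0.
(* Every dart sum is twice an edge sum, so the sides are [4 M_2 n] and [4 m M_1]. *)
have : (((\sum_(e in darts G) p e) * (\sum_(e in darts G) h e)
    < #|darts G|%:R * \sum_(e in darts G) p e * h e))%R.
  rewrite sum_h sum_ph sum_darts_deg_mul card_darts natrM.
  move: ratio_gt; rewrite ltr_pdivrMr ?ltr0n // mulrAC ltr_pdivlMr ?ltr0n //.
  lra.
case/chebyshev_concordant => -[u v] [[x y]]; rewrite !inE /p /h /=.
case=> uv xy; rewrite -!natrM ltr_nat => lt_p lt_h.
exists u, v, x, y; split=> //.
rewrite -(ltr_nat rat) !natrM !natrD -!/(d _).
have := lt_h; rewrite -(ltr_pM2r (_ : 0 < d x * d y * (d u * d v))%R); last first.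
  by rewrite !mulr_gt0.
congr (_ < _)%R; field; by rewrite !dn0.
Qed.

Theorem corollary2p2 (G : sgraph) (non_null : 0 < gorder G)
  (no_isolated : forall v : G, ~~ isolated v)
  (deg_gap : max_deg G - min_deg G <= 3)
  (ratio_gt : ((zagreb1 G)%:R / (gorder G)%:R >
               (zagreb2 G)%:R / (gsize G)%:R :> rat)%R) :
  [/\ min_deg G = 2, max_deg G = 5,
      edge_count G 2 5 <> 0 & edge_count G 3 3 <> 0].
Proof.
have pos (v : G) : 0 < deg v by rewrite lt0n; exact: no_isolated.
have bnd (v : G) : min_deg G <= deg v <= min_deg G + 3.
  by have := min_deg_le v; have := max_deg_ge v; lia.
have [u [v [x [y [uv xy lt_p lt_h]]]]] :=
  exists_concordant_edges non_null pos ratio_gt.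
have [d2 e25 x3 y3] := concordant_types (min_deg_gt0 non_null pos)
  (bnd u) (bnd v) (bnd x) (bnd y) lt_p lt_h.
(* One of [u], [v] has degree 5, and [deg_gap] with [d2] bounds the maximum by 2 + 3. *)
have := max_deg_ge u; have := max_deg_ge v.
split; [exact: d2 | lia | | by rewrite -{1}x3 -y3; exact: edge_count_neq0].
case: e25 => [][<- <-]; first exact: edge_count_neq0.
by apply: edge_count_neq0; rewrite adj_sym.
Qed.
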